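(* Let $X$ be a rack, $k$ a commutative ring with unit, and let $B$ be the $k$-algebra generated by symbols $x$ and $e_x$ ($x\in X$) subject to the relations $yx^y=xy$ and $y\,e_{x^y}=e_x\,y$ for all $x,y\in X$, graded by $|x|=0$ and $|e_x|=1$. Then the assignments $$d(e_x)=1-x,\qquad d(x)=0,\qquad \Delta(x)=x\otimes x,\qquad \Delta(e_x)=e_x\otimes x+1\otimes e_x\qquad(x\in X)$$ extend (uniquely) to a well-defined super-derivation $d:B_\bullet\to B_{\bullet-1}$ of degree $-1$ and a well-defined graded algebra morphism $\Delta:B\to B\otimes B$, and with these structures $B$ is a differential graded bialgebra.
   Context: A rack is a nonempty set $X$ with a binary operation $(x,y)\mapsto x\triangleleft y=x^y$ such that $-\triangleleft y:X\to X$ is a bijection for every $y\in X$, and $(x\triangleleft y)\triangleleft z=(x\triangleleft z)\triangleleft(y\triangleleft z)$ for all $x,y,z\in X$. All tensor products are over $k$. The tensor product $B\otimes B$ carries the graded (Koszul-signed) algebra structure $(a\otimes b)(a'\otimes b')=(-1)^{|b||a'|}aa'\otimes bb'$. A super-derivation of degree $-1$ satisfies $d(ab)=d(a)b+(-1)^{|a|}a\,d(b)$ for homogeneous $a$. A differential graded bialgebra is a graded bialgebra (associative unital algebra, coassociative counital coalgebra, with $\Delta$ an algebra morphism into $B\otimes B$ with the Koszul-signed product) equipped with a degree $-1$ map $d$ with $d^2=0$ which is both a super-derivation for the multiplication and a super-coderivation for the comultiplication, i.e. $\Delta\circ d=(d\otimes 1+1\otimes d)\circ\Delta$, where $(1\otimes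 d)(a\otimes b)=(-1)^{|a|}a\otimes d(b)$. *)

(* Defs.v *)
From HB Require Import structures.
From mathcomp Require Import all_boot all_algebra.
From mathcomp Require Import boolp.

Set Implicit Arguments.
Unset Strict Implicit.
Unset Printing Implicit Defensive.

Import GRing.Theory.
Local Open Scope ring_scope.
Local Open Scope quotient_scope.

Section LinearFacts.
Variables (k : pzRingType) (U V : lmodType k).
Implicit Type f : U -> V.

Lemma lin0 f : linear f -> f 0 = 0.
Proof. by move=> hf; have := hf (-1) 0 0; rewrite !scaler0 addr0 scaleN1r addNr. Qed.

Lemma linD f : linear f -> {morph f : u v / u + v}.
Proof. by move=> hf u v; rewrite -{1}[u]scale1r hf scale1r. Qed.

Lemma linZ f : linear f -> forall c u, f (c *: u) = c *: f u.
Proof. by move=> hf c u; rewrite -[c *: u in LHS]addr0 hf lin0 // addr0. Qed.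

Lemma lin_sum f (hf : linear f) I (r : seq I) (P : pred I) (F : I -> U) :
  f (\sum_(i <- r | P i) F i) = \sum_(i <- r | P i) f (F i).
Proof. exact: (big_morph f (linD hf) (lin0 hf)). Qed.

End LinearFacts.

Inductive term (k G : Type) : Type :=
| Gen of G
| Zero
| One
| Add of term k G & term k G
| Mul of term k G & term k G
| Scale of k & term k G.
Arguments Zero {k G}.
Arguments One {k G}.
Arguments Gen {k G}.

Section Presented.
Variables (k : comPzRingType) (G : Type) (R : term k G -> term k G -> Prop).

(* The least congruence containing R whose quotient is an associative unital
   k-algebra; the opposite of t is the class of Scale (-1) t. *)
Inductive pcongr : term k G -> term k G -> Prop :=
| pc_rel s t : R s t -> pcongr s t
| pc_refl s : pcongr s s
| pc_sym s t : pcongr s t -> pcongr t s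
| pc_trans s t u : pcongr s t -> pcongr t u -> pcongr s u
| pc_add s s' t t' : pcongr s s' -> pcongr t t' -> pcongr (Add s t) (Add s' t')
| pc_mul s s' t t' : pcongr s s' -> pcongr t t' -> pcongr (Mul s t) (Mul s' t')
| pc_scale c s s' : pcongr s s' -> pcongr (Scale c s) (Scale c s')
| pc_addA s t u : pcongr (Add s (Add t u)) (Add (Add s t) u)
| pc_addC s t : pcongr (Add s t) (Add t s)
| pc_add0 s : pcongr (Add Zero s) s
| pc_addN s : pcongr (Add (Scale (-1) s) s) Zero
| pc_scaleA c c' s : pcongr (Scale c (Scale c' s)) (Scale (c * c') s)
| pc_scale1 s : pcongr (Scale 1 s) s
| pc_scaleDr c s t : pcongr (Scale c (Add s t)) (Add (Scale c s) (Scale c t))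
| pc_scaleDl c c' s : pcongr (Scale (c + c') s) (Add (Scale c s) (Scale c' s))
| pc_mulA s t u : pcongr (Mul s (Mul t u)) (Mul (Mul s t) u)
| pc_mul1l s : pcongr (Mul One s) s
| pc_mul1r s : pcongr (Mul s One) s
| pc_mulDl s t u : pcongr (Mul (Add s t) u) (Add (Mul s u) (Mul t u))
| pc_mulDr s t u : pcongr (Mul s (Add t u)) (Add (Mul s t) (Mul s u))
| pc_scaleAl c s t : pcongr (Scale c (Mul s t)) (Mul (Scale c s) t)
| pc_scaleAr c s t : pcongr (Scale c (Mul s t)) (Mul s (Scale c t)).

Definition pcongrb : rel {classic term k G} := fun s t => `[< pcongr s t >].

Lemma pcongrb_equiv : equiv_class_of pcongrb.
Proof.
split=> [s|s t|t s u]; first by apply/asboolP; exact: pc_refl.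
  by apply/asboolP/asboolP; exact: pc_sym.
by move=> /asboolP h /asboolP h'; apply/asboolP; exact: pc_trans h h'.
Qed.
Canonical pcongr_equiv := EquivRelPack pcongrb_equiv.

Definition palg : Type := {eq_quot pcongr_equiv}.
HB.instance Definition _ := Choice.on palg.

Definition pcls (s : term k G) : palg :=
  \pi_({eq_quot pcongr_equiv}) (s : {classic term k G}).
Definition prep (a : palg) : term k G :=
  repr (a : {eq_quot pcongr_equiv}).

Lemma prepK : cancel prep pcls.
Proof. exact: reprK. Qed.

Lemma pcls_eq s t : pcls s = pcls t <-> pcongr s t.
Proof.
split=> [h|/asboolP h]; last exact: (elimT (eqmodP pcongr_equiv _ _) h).
exact/asboolP/(introT (eqmodP pcongr_equiv _ _) h).
Qed.

Lemma prep_pcls s : pcongr (prep (pcls s)) s.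
Proof. by apply/pcls_eq; rewrite prepK. Qed.

Definition padd (a b : palg) := pcls (Add (prep a) (prep b)).
Definition popp (a : palg) := pcls (Scale (-1) (prep a)).
Definition pmul (a b : palg) := pcls (Mul (prep a) (prep b)).
Definition pscale (c : k) (a : palg) := pcls (Scale c (prep a)).

Lemma paddE s t : padd (pcls s) (pcls t) = pcls (Add s t).
Proof. by apply/pcls_eq/pc_add; exact: prep_pcls. Qed.
Lemma pmulE s t : pmul (pcls s) (pcls t) = pcls (Mul s t).
Proof. by apply/pcls_eq/pc_mul; exact: prep_pcls. Qed.
Lemma pscaleE c s : pscale c (pcls s) = pcls (Scale c s).
Proof. by apply/pcls_eq/pc_scale; exact: prep_pcls. Qed.
Lemma poppE s : popp (pcls s) = pcls (Scale (-1) s).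
Proof. exact: pscaleE. Qed.

Lemma palgW (P : palg -> Prop) : (forall s, P (pcls s)) -> forall a, P a.
Proof. by move=> h a; rewrite -[a]prepK. Qed.

Let pE := (paddE, pmulE, pscaleE, poppE).

Lemma paddA : associative padd.
Proof.
elim/palgW=> s; elim/palgW=> t; elim/palgW=> u; rewrite !pE.
exact/pcls_eq/pc_addA.
Qed.
Lemma paddC : commutative padd.
Proof. by elim/palgW=> s; elim/palgW=> t; rewrite !pE; exact/pcls_eq/pc_addC. Qed.
Lemma padd0 : left_id (pcls Zero) padd.
Proof. by elim/palgW=> s; rewrite !pE; exact/pcls_eq/pc_add0. Qed.
Lemma paddN : left_inverse (pcls Zero) popp padd.
Proof. by elim/palgW=> s; rewrite !pE; exact/pcls_eq/pc_addN. Qed.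

HB.instance Definition _ := GRing.isZmodule.Build palg paddA paddC padd0 paddN.

Lemma pmulA : associative pmul.
Proof.
elim/palgW=> s; elim/palgW=> t; elim/palgW=> u; rewrite !pE.
exact/pcls_eq/pc_mulA.
Qed.
Lemma pmul1l : left_id (pcls One) pmul.
Proof. by elim/palgW=> s; rewrite !pE; exact/pcls_eq/pc_mul1l. Qed.
Lemma pmul1r : right_id (pcls One) pmul.
Proof. by elim/palgW=> s; rewrite !pE; exact/pcls_eq/pc_mul1r. Qed.
Lemma pmulDl : left_distributive pmul padd.
Proof.
elim/palgW=> s; elim/palgW=> t; elim/palgW=> u; rewrite !pE.
exact/pcls_eq/pc_mulDl.
Qed.
Lemma pmulDr : right_distributive pmul padd.
Proof.
elim/palgW=> s; elim/palgW=> t; elim/palgW=> u; rewrite !pE.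
exact/pcls_eq/pc_mulDr.
Qed.

HB.instance Definition _ :=
  GRing.Zmodule_isPzRing.Build palg pmulA pmul1l pmul1r pmulDl pmulDr.

Lemma pscaleA c c' a : pscale c (pscale c' a) = pscale (c * c') a.
Proof. by elim/palgW: a => s; rewrite !pE; exact/pcls_eq/pc_scaleA. Qed.
Lemma pscale1 : left_id 1 pscale.
Proof. by elim/palgW=> s; rewrite !pE; exact/pcls_eq/pc_scale1. Qed.
Lemma pscaleDr : right_distributive pscale +%R.
Proof.
move=> c; elim/palgW=> s; elim/palgW=> t; rewrite /GRing.add /= !pE.
exact/pcls_eq/pc_scaleDr.
Qed.
Lemma pscaleDl a : {morph pscale^~ a : c c' / c + c'}.
Proof.
move=> c c'; elim/palgW: a => s; rewrite [RHS]/GRing.add /= !pE.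
exact/pcls_eq/pc_scaleDl.
Qed.

HB.instance Definition _ :=
  GRing.Zmodule_isLmodule.Build k palg pscaleA pscale1 pscaleDr pscaleDl.

Lemma pscalerAl (c : k) (a b : palg) : c *: (a * b) = (c *: a) * b.
Proof.
elim/palgW: a => s; elim/palgW: b => t.
rewrite /GRing.scale /GRing.mul /= !pE; exact/pcls_eq/pc_scaleAl.
Qed.
Lemma pscalerAr (c : k) (a b : palg) : c *: (a * b) = a * (c *: b).
Proof.
elim/palgW: a => s; elim/palgW: b => t.
rewrite /GRing.scale /GRing.mul /= !pE; exact/pcls_eq/pc_scaleAr.
Qed.

Lemma pcls0 : pcls Zero = 0. Proof. by []. Qed.
Lemma pcls1 : pcls One = 1. Proof. by []. Qed.
Lemma pclsD s t : pcls (Add s t) = pcls s + pcls t.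
Proof. by rewrite [RHS]paddE. Qed.
Lemma pclsM s t : pcls (Mul s t) = pcls s * pcls t.
Proof. by rewrite [RHS]pmulE. Qed.
Lemma pclsZ c s : pcls (Scale c s) = c *: pcls s.
Proof. by rewrite [RHS]pscaleE. Qed.

End Presented.

Definition bilin (k : pzRingType) (M N P : lmodType k) (f : M -> N -> P) : Prop :=
  (forall m, linear (f m)) /\ (forall n, linear (f^~ n)).

Inductive tterm (k M N : Type) : Type :=
| TPure of M & N
| TZero
| TAdd of tterm k M N & tterm k M N
| TScale of k & tterm k M N.
Arguments TZero {k M N}.
Arguments TPure {k M N}.

Section Tensor.
Variables (k : comPzRingType) (M N : lmodType k).
Local Notation tm := (tterm k M N).

(* The least k-module congruence making TPure bilinear. *)
Inductive tcongr : tm -> tm -> Prop :=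
| tc_refl s : tcongr s s
| tc_sym s t : tcongr s t -> tcongr t s
| tc_trans s t u : tcongr s t -> tcongr t u -> tcongr s u
| tc_add s s' t t' : tcongr s s' -> tcongr t t' -> tcongr (TAdd s t) (TAdd s' t')
| tc_scale c s s' : tcongr s s' -> tcongr (TScale c s) (TScale c s')
| tc_addA s t u : tcongr (TAdd s (TAdd t u)) (TAdd (TAdd s t) u)
| tc_addC s t : tcongr (TAdd s t) (TAdd t s)
| tc_add0 s : tcongr (TAdd TZero s) s
| tc_addN s : tcongr (TAdd (TScale (-1) s) s) TZero
| tc_scaleA c c' s : tcongr (TScale c (TScale c' s)) (TScale (c * c') s)
| tc_scale1 s : tcongr (TScale 1 s) s
| tc_scaleDr c s t : tcongr (TScale c (TAdd s t)) (TAdd (TScale c s) (TScale c t))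
| tc_scaleDl c c' s : tcongr (TScale (c + c') s) (TAdd (TScale c s) (TScale c' s))
| tc_pureDl m m' n : tcongr (TPure (m + m') n) (TAdd (TPure m n) (TPure m' n))
| tc_pureDr m n n' : tcongr (TPure m (n + n')) (TAdd (TPure m n) (TPure m n'))
| tc_pureZl c m n : tcongr (TPure (c *: m) n) (TScale c (TPure m n))
| tc_pureZr c m n : tcongr (TPure m (c *: n)) (TScale c (TPure m n)).

Definition tcongrb : rel {classic tm} := fun s t => `[< tcongr s t >].

Lemma tcongrb_equiv : equiv_class_of tcongrb.
Proof.
split=> [s|s t|t s u]; first by apply/asboolP; exact: tc_refl.
  by apply/asboolP/asboolP; exact: tc_sym.
by move=> /asboolP h /asboolP h'; apply/asboolP; exact: tc_trans h h'.
Qed.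
Canonical tcongr_equiv := EquivRelPack tcongrb_equiv.

Definition tens : Type := {eq_quot tcongr_equiv}.
HB.instance Definition _ := Choice.on tens.

Definition tcls (s : tm) : tens := \pi_({eq_quot tcongr_equiv}) (s : {classic tm}).
Definition trep (a : tens) : tm := repr (a : {eq_quot tcongr_equiv}).

Lemma trepK : cancel trep tcls.
Proof. exact: reprK. Qed.

Lemma tcls_eq s t : tcls s = tcls t <-> tcongr s t.
Proof.
split=> [h|/asboolP h]; last exact: (elimT (eqmodP tcongr_equiv _ _) h).
exact/asboolP/(introT (eqmodP tcongr_equiv _ _) h).
Qed.

Lemma trep_tcls s : tcongr (trep (tcls s)) s.
Proof. by apply/tcls_eq; rewrite trepK. Qed.

Definition tadd (a b : tens) := tcls (TAdd (trep a) (trep b)).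
Definition topp (a : tens) := tcls (TScale (-1) (trep a)).
Definition tscale (c : k) (a : tens) := tcls (TScale c (trep a)).

Lemma taddE s t : tadd (tcls s) (tcls t) = tcls (TAdd s t).
Proof. by apply/tcls_eq/tc_add; exact: trep_tcls. Qed.
Lemma tscaleE c s : tscale c (tcls s) = tcls (TScale c s).
Proof. by apply/tcls_eq/tc_scale; exact: trep_tcls. Qed.
Lemma toppE s : topp (tcls s) = tcls (TScale (-1) s).
Proof. exact: tscaleE. Qed.

Lemma tensW (P : tens -> Prop) : (forall s, P (tcls s)) -> forall a, P a.
Proof. by move=> h a; rewrite -[a]trepK. Qed.

Let tE := (taddE, tscaleE, toppE).

Lemma taddA : associative tadd.
Proof.
elim/tensW=> s; elim/tensW=> t; elim/tensW=> u; rewrite !tE.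
exact/tcls_eq/tc_addA.
Qed.
Lemma taddC : commutative tadd.
Proof. by elim/tensW=> s; elim/tensW=> t; rewrite !tE; exact/tcls_eq/tc_addC. Qed.
Lemma tadd0 : left_id (tcls TZero) tadd.
Proof. by elim/tensW=> s; rewrite !tE; exact/tcls_eq/tc_add0. Qed.
Lemma taddN : left_inverse (tcls TZero) topp tadd.
Proof. by elim/tensW=> s; rewrite !tE; exact/tcls_eq/tc_addN. Qed.

HB.instance Definition _ := GRing.isZmodule.Build tens taddA taddC tadd0 taddN.

Lemma tscaleA c c' a : tscale c (tscale c' a) = tscale (c * c') a.
Proof. by elim/tensW: a => s; rewrite !tE; exact/tcls_eq/tc_scaleA. Qed.
Lemma tscale1 : left_id 1 tscale.
Proof. by elim/tensW=> s; rewrite !tE; exact/tcls_eq/tc_scale1. Qed.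
Lemma tscaleDr : right_distributive tscale +%R.
Proof.
move=> c; elim/tensW=> s; elim/tensW=> t; rewrite /GRing.add /= !tE.
exact/tcls_eq/tc_scaleDr.
Qed.
Lemma tscaleDl a : {morph tscale^~ a : c c' / c + c'}.
Proof.
move=> c c'; elim/tensW: a => s; rewrite [RHS]/GRing.add /= !tE.
exact/tcls_eq/tc_scaleDl.
Qed.

HB.instance Definition _ :=
  GRing.Zmodule_isLmodule.Build k tens tscaleA tscale1 tscaleDr tscaleDl.

Definition tpure (m : M) (n : N) : tens := tcls (TPure m n).

Lemma tclsD s t : tcls (TAdd s t) = tcls s + tcls t.
Proof. by rewrite [RHS]taddE. Qed.
Lemma tclsZ c s : tcls (TScale c s) = c *: tcls s.
Proof. by rewrite [RHS]tscaleE. Qed.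

Lemma tpure_bilin : bilin tpure.
Proof.
split=> [m c n n'|n c m m'] /=; rewrite /tpure -tclsZ -tclsD; apply/tcls_eq.
  apply/(tc_trans (tc_pureDr _ _ _))/tc_add/tc_refl; exact: tc_pureZr.
apply/(tc_trans (tc_pureDl _ _ _))/tc_add/tc_refl; exact: tc_pureZl.
Qed.

Lemma tens_ind (P : tens -> Prop) :
    (forall m n, P (tpure m n)) -> (forall s t, P s -> P t -> P (s + t)) ->
  forall t, P t.
Proof.
move=> hp hD; elim/tensW=> s.
have hZ c m n : c *: tpure m n = tpure (c *: m) n by rewrite (linZ (tpure_bilin.2 n)).
suff: forall c : k, P (c *: tcls s) by move=> /(_ 1); rewrite scale1r.
elim: s => [m n|||c' s IHs] => [c||s IHs t IHt c|c].
- by rewrite hZ.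
- by move=> c; rewrite (_ : tcls TZero = 0) // scaler0 -(lin0 (tpure_bilin.1 0)).
- by rewrite tclsD scalerDr; exact: hD.
- by rewrite tclsZ scalerA.
Qed.

Lemma tens_ext (P : lmodType k) (f g : tens -> P) : linear f -> linear g ->
  (forall m n, f (tpure m n) = g (tpure m n)) -> f =1 g.
Proof.
move=> hf hg h; apply: tens_ind => // s t hs ht.
by rewrite (linD hf) (linD hg) hs ht.
Qed.

Section Lift.
Variables (P : lmodType k) (f : M -> N -> P).

Fixpoint teval (s : tm) : P :=
  match s with
  | TPure m n => f m n
  | TZero => 0
  | TAdd s t => teval s + teval t
  | TScale c s => c *: teval s
  end.

Definition tlift (hf : bilin f) (t : tens) : P := teval (trep t).

Hypothesis hf : bilin f.

Lemma teval_congr s t : tcongr s t -> teval s = teval t.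
Proof.
case: hf => hf1 hf2.
elim=> //= *; rewrite ?addrA ?add0r ?scaleN1r ?addNr ?scalerA ?scale1r ?scalerDr
  ?scalerDl ?(linD (hf1 _)) ?(linD (hf2 _)) ?(linZ (hf1 _)) ?(linZ (hf2 _)) //;
  try congruence.
- exact: addrC.
Qed.

Lemma tlift_cls s : tlift hf (tcls s) = teval s.
Proof. exact/teval_congr/trep_tcls. Qed.

Lemma tliftE m n : tlift hf (tpure m n) = f m n.
Proof. exact: tlift_cls. Qed.

Lemma tlift_linear : linear (tlift hf).
Proof.
move=> c; elim/tensW=> s; elim/tensW=> t.
by rewrite -tclsZ -tclsD !tlift_cls.
Qed.

HB.instance Definition _ :=
  GRing.isLinear.Build k tens P _ (tlift hf) tlift_linear.

End Lift.
End Tensor.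

Notation "A ⊗ B" := (tens A%type B%type) (at level 40, left associativity) : type_scope.
Notation "a ⊗ b" := (tpure a b) (at level 40, left associativity) : ring_scope.

(* A k-algebra A = A_0 (+) A_1 (+) ... with A_m A_n included in A_(m+n) and 1 in
   A_0, given by the projections gcomp n onto the A_n. This does not extend
   algType, whose carriers are nontrivial rings: 1 = 0 may hold in k and in a
   tensor product of algebras. *)
HB.mixin Record isGradedAlgebra (k : comPzRingType) A of GRing.Lmodule k A := {
  gone : A;
  gmul : A -> A -> A;
  gmulA : associative gmul;
  gmul1l : left_id gone gmul;
  gmul1r : right_id gone gmul;
  gmulDl : left_distributive gmul +%R;
  gmulDr : right_distributive gmul +%R;
  gscaleAl : forall (c : k) a b, c *: gmul a b = gmul (c *: a) b;
  gscaleAr : forall (c : k) a b, c *: gmul a b = gmul a (c *: b);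
  gcomp : nat -> A -> A;
  gcomp_lin : forall n, linear (gcomp n);
  gcompK : forall m n a, gcomp m (gcomp n a) = if m == n then gcomp n a else 0;
  gcomp_sum : forall a, exists N : nat, a = \sum_(i < N) gcomp i a;
  gcomp_gone : gcomp 0 gone = gone;
  gcomp_gmul : forall m n a b,
    gcomp (m + n) (gmul (gcomp m a) (gcomp n b)) = gmul (gcomp m a) (gcomp n b)
}.

#[short(type="gradedAlgType")]
HB.structure Definition GradedAlgebra (k : comPzRingType) :=
  { A of isGradedAlgebra k A & GRing.Lmodule k A }.

HB.instance Definition _ (k : comPzRingType) (A : gradedAlgType k) :=
  GRing.Zmodule_isPzRing.Build A
    (@gmulA k A) (@gmul1l k A) (@gmul1r k A) (@gmulDl k A) (@gmulDr k A).

Section Decomposition.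
Variables (k : comPzRingType) (V : lmodType k) (c : nat -> V -> V).
Hypothesis c_lin : forall n, linear (c n).
Hypothesis cK : forall m n a, c m (c n a) = if m == n then c n a else 0.

Definition fsum (a : V) :=
  exists N, forall M, (N <= M)%N -> a = \sum_(i < M) c i a.

Lemma fsumD a b : fsum a -> fsum b -> fsum (a + b).
Proof.
move=> [N hN] [N' hN']; exists (maxn N N') => M; rewrite geq_max => /andP[h h'].
under eq_bigr do rewrite (linD (c_lin _)).
by rewrite big_split /= -hN // -hN'.
Qed.

Lemma fsum_homog n a : c n a = a -> fsum a.
Proof.
move=> ha; exists n.+1 => M hM; rewrite -[in RHS]ha.
under eq_bigr do rewrite cK.
by rewrite (bigD1 (Ordinal hM)) //= eqxx ha big1 ?addr0 // => i /negPf; rewrite -val_eqE /= => ->.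
Qed.

Lemma fsum0 : fsum 0.
Proof. by apply: (@fsum_homog 0%N); rewrite (lin0 (c_lin _)). Qed.

Lemma fsum_sum N (F : nat -> V) :
  (forall i, fsum (F i)) -> fsum (\sum_(i < N) F i).
Proof. by move=> h; elim/big_ind: _ => //; [exact: fsum0 | exact: fsumD]. Qed.

Lemma fsumW a : (exists N, a = \sum_(i < N) c i a) -> fsum a.
Proof.
move=> [N ->]; apply: (@fsum_sum N (c^~ a)) => i.
by apply: (@fsum_homog i); rewrite cK eqxx.
Qed.

End Decomposition.

Section Graded.
Variables (k : comPzRingType) (A : gradedAlgType k).
Implicit Types a b : A.

Lemma scale_mull (c : k) a b : c *: (a * b) = (c *: a) * b.
Proof. exact: gscaleAl. Qed.

Lemma scale_mulr (c : k) a b : c *: (a * b) = a * (c *: b).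
Proof. exact: gscaleAr. Qed.

HB.instance Definition _ n :=
  GRing.isLinear.Build k A A _ (@gcomp k A n) (@gcomp_lin k A n).

Definition homog (n : nat) (a : A) : Prop := gcomp n a = a.

Lemma homogP n a m : homog n a -> gcomp m a = if m == n then a else 0.
Proof. by move=> h; rewrite -h gcompK h. Qed.

Lemma homog_gcomp n a : homog n (gcomp n a).
Proof. by rewrite /homog gcompK eqxx. Qed.

Lemma homogD n a b : homog n a -> homog n b -> homog n (a + b).
Proof. by rewrite /homog linearD /= => -> ->. Qed.

Lemma homogZ n (c : k) a : homog n a -> homog n (c *: a).
Proof. by rewrite /homog linearZ /= => ->. Qed.

Lemma homog0 n : homog n (0 : A).
Proof. exact: linear0. Qed.

Lemma homogM m n a b : homog m a -> homog n b -> homog (m + n)%N (a * b).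
Proof. by move=> <- <-; exact: gcomp_gmul. Qed.

Lemma homog1 : homog 0 (1 : A).
Proof. exact: gcomp_gone. Qed.

Lemma gcomp_fsum a : fsum (@gcomp k A) a.
Proof. exact: (fsumW (@gcomp_lin _ _) (@gcompK _ _)) (gcomp_sum a). Qed.

Lemma homog_ind (P : A -> Prop) :
    (forall n a, homog n a -> P a) -> (forall a b, P a -> P b -> P (a + b)) ->
  forall a, P a.
Proof.
move=> hh hD a; have [N ->] := gcomp_sum a.
apply: (big_ind P) => //; first exact/(hh 0%N)/homog0.
by move=> i _; exact/hh/homog_gcomp.
Qed.

Definition gbound a : nat := sval (cid (gcomp_fsum a)).

(* gsum h a is the sum over i of h i (a_i), where a_i is the component of
   degree i of a. *)
Definition gsum (V : lmodType k) (h : nat -> A -> V) (a : A) : V :=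
  \sum_(i < gbound a) h i (gcomp i a).

Section Gsum.
Variables (V : lmodType k) (h : nat -> A -> V).
Hypothesis h_lin : forall i, linear (h i).

Lemma gsum_widen a M : (gbound a <= M)%N ->
  gsum h a = \sum_(i < M) h i (gcomp i a).
Proof.
move=> hM; rewrite /gsum (big_ord_widen _ (fun i => h i (gcomp i a)) hM).
rewrite big_mkcond; apply: eq_bigr => i _; case: ifP => // /negbT.
rewrite -leqNgt => hi.
suff -> : gcomp i a = 0 by rewrite (lin0 (h_lin _)).
rewrite /gbound in hM hi; case: (cid _) hM hi => N /= hN _ hi.
rewrite [X in gcomp i X](hN _ (leqnn _)) linear_sum big1 // => j _ /=.
by rewrite gcompK gtn_eqF // (leq_trans (ltn_ord j)).
Qed.

Lemma gsum_linear : linear (gsum h).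
Proof.
move=> c a b; set M := maxn (gbound (c *: a + b)) (maxn (gbound a) (gbound b)).
rewrite !(@gsum_widen _ M) ?leq_max ?leqnn ?orbT // scaler_sumr -big_split /=.
by apply: eq_bigr => i _; rewrite linearP h_lin.
Qed.

Lemma gsum_homog n a : homog n a -> gsum h a = h n a.
Proof.
move=> ha; rewrite (@gsum_widen _ (maxn (gbound a) n.+1)) ?leq_maxl //.
have hn : (n < maxn (gbound a) n.+1)%N by rewrite leq_max leqnn orbT.
rewrite (bigD1 (Ordinal hn)) //= ha big1 ?addr0 // => i.
by rewrite -val_eqE /= => /negPf hi; rewrite (homogP _ ha) hi (lin0 (h_lin _)).
Qed.

End Gsum.

(* The grading involution a |-> (-1)^|a| a. *)
Definition gsign : A -> A := gsum (fun i a => (-1) ^+ i *: a).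

Lemma gsign_lin_aux i : linear (fun a : A => ((-1) ^+ i : k) *: a).
Proof. by move=> c a b; rewrite scalerDr !scalerA mulrC. Qed.

HB.instance Definition _ := GRing.isLinear.Build k A A _ gsign
  (gsum_linear gsign_lin_aux).

Lemma gsignE n a : homog n a -> gsign a = (-1) ^+ n *: a.
Proof. exact: (gsum_homog gsign_lin_aux). Qed.

End Graded.
Arguments gsign {k A}.

Section TensorMaps.
Variable k : comPzRingType.

Section Tmap.
Variables (M N M' N' : lmodType k).
Variables (f : {linear M -> M'}) (g : {linear N -> N'}).

Lemma tmap_bilin : bilin (fun m n => f m ⊗ g n).
Proof.
split=> [m c n n'|n c m m'] /=; rewrite linearP.
  exact: (tpure_bilin _ _).1.
exact: (tpure_bilin _ _).2.
Qed.

Definition tmap : M ⊗ N -> M' ⊗ N' := tlift tmap_bilin.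
HB.instance Definition _ := GRing.Linear.on tmap.

Lemma tmapE m n : tmap (m ⊗ n) = f m ⊗ g n.
Proof. exact: tliftE. Qed.

End Tmap.

Section Tassoc.
Variables (M N P : lmodType k).

Lemma tassoc_bilin1 (p : P) : bilin (fun (m : M) (n : N) => m ⊗ (n ⊗ p)).
Proof.
split=> [m c n n'|n c m m'] /=; last exact: (tpure_bilin _ _).2.
by rewrite (tpure_bilin N P).2 (tpure_bilin _ _).1.
Qed.

Lemma tassoc_bilin2 :
  bilin (fun (t : M ⊗ N) (p : P) => tlift (tassoc_bilin1 p) t).
Proof.
split=> [t c p p'|p c s t] /=; last exact: (tlift_linear (tassoc_bilin1 p)).
elim/tens_ind: t => [m n|s t hs ht].
  by rewrite !tliftE (tpure_bilin N P).1 (tpure_bilin _ _).1.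
by rewrite !(linD (tlift_linear _)) hs ht scalerDr addrACA.
Qed.

Definition tassoc : (M ⊗ N) ⊗ P -> M ⊗ (N ⊗ P) := tlift tassoc_bilin2.
HB.instance Definition _ := GRing.Linear.on tassoc.

Lemma tassocE m n p : tassoc (m ⊗ n ⊗ p) = m ⊗ (n ⊗ p).
Proof. by rewrite /tassoc !tliftE. Qed.

End Tassoc.

Section Tunit.
Variable M : lmodType k.

Lemma tunitl_bilin : bilin (fun (c : k^o) (m : M) => (c : k) *: m).
Proof.
split=> [c d m m'|m d c c'] /=; last by rewrite scalerDl scalerA.
by rewrite scalerDr !scalerA mulrC.
Qed.

Lemma tunitr_bilin : bilin (fun (m : M) (c : k^o) => (c : k) *: m).
Proof. by case: tunitl_bilin => h h'; split. Qed.

Definition tunitl : k^o ⊗ M -> M := tlift tunitl_bilin.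
Definition tunitr : M ⊗ k^o -> M := tlift tunitr_bilin.
HB.instance Definition _ := GRing.Linear.on tunitl.
HB.instance Definition _ := GRing.Linear.on tunitr.

Lemma tunitlE c m : tunitl (c ⊗ m) = (c : k) *: m.
Proof. exact: tliftE. Qed.
Lemma tunitrE m c : tunitr (m ⊗ c) = (c : k) *: m.
Proof. exact: tliftE. Qed.

End Tunit.
End TensorMaps.

Section Koszul.
Variables (k : comPzRingType) (A B : gradedAlgType k).
Local Notation T := (A ⊗ B)%type.

Lemma mull_lin (C : gradedAlgType k) (a : C) : linear (fun x : C => a * x).
Proof. by move=> c u v; rewrite mulrDr scale_mulr. Qed.

Lemma mulr_lin (C : gradedAlgType k) (b : C) : linear (fun x : C => x * b).
Proof. by move=> c u v /=; rewrite mulrDl scale_mull. Qed.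

Lemma tens_homog_ind (P : T -> Prop) :
    (forall i j (a : A) (b : B), homog i a -> homog j b -> P (a ⊗ b)) ->
    (forall s t, P s -> P t -> P (s + t)) ->
  forall t, P t.
Proof.
move=> hh hD; apply: tens_ind => // a; elim/homog_ind => [j b hb|b b' h h'].
  elim/homog_ind: a => [i a ha|a a' h h']; first exact: hh ha hb.
  by rewrite (linD ((tpure_bilin _ _).2 b)); exact: hD.
by rewrite (linD ((tpure_bilin _ _).1 a)); exact: hD.
Qed.

(* (a (x) b)(a' (x) b') is the sum over the degrees i of b and j of a' of
   (-1)^(ij) a a'_j (x) b_i b'. *)
Definition kpure (a : A) (b : B) (a' : A) (b' : B) : T :=
  gsum (fun i bi => gsum (fun j aj => (-1) ^+ (i * j) *: ((a * aj) ⊗ (bi * b'))) a') b.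

Lemma kpure_lin1 (i j : nat) (a : A) (b b' : B) :
  linear (fun a' : A => ((-1) ^+ (i * j) : k) *: ((a * a') ⊗ (b * b'))).
Proof.
move=> c u v; rewrite mull_lin (tpure_bilin _ _).2.
by rewrite scalerDr !scalerA mulrC.
Qed.

Lemma kpure_lin2 i (a a' : A) (b' : B) : linear (fun b : B =>
  gsum (fun j aj => ((-1) ^+ (i * j) : k) *: ((a * aj) ⊗ (b * b'))) a').
Proof.
move=> c u v; rewrite /gsum scaler_sumr -big_split /=; apply: eq_bigr => j _.
rewrite mulr_lin (tpure_bilin _ _).1.
by rewrite scalerDr !scalerA mulrC.
Qed.

Lemma kpureE i j a b a' b' : homog i b -> homog j a' ->
  kpure a b a' b' = (-1) ^+ (i * j) *: ((a * a') ⊗ (b * b')).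
Proof.
move=> hb ha'; rewrite /kpure (gsum_homog _ hb); last by move=> n; exact: kpure_lin2.
by rewrite (gsum_homog _ ha') // => n; exact: kpure_lin1.
Qed.

Lemma kpure_bilin a b : bilin (kpure a b).
Proof.
split=> [a' c u v|b' c u v] /=; rewrite /kpure.
  rewrite /gsum scaler_sumr -big_split /=; apply: eq_bigr => i _.
  rewrite scaler_sumr -big_split /=; apply: eq_bigr => j _.
  by rewrite mull_lin (tpure_bilin _ _).1 scalerDr !scalerA mulrC.
rewrite [X in _ = c *: X + _]/gsum [X in _ = _ + X]/gsum [LHS]/gsum.
rewrite scaler_sumr -big_split /=; apply: eq_bigr => i _.
by apply: (gsum_linear (fun j => kpure_lin1 i j a (gcomp i b) b')).
Qed.

Lemma kmul_bilin (u : T) : bilin (fun a b => tlift (kpure_bilin a b) u).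
Proof.
elim/tens_ind: u => [a' b'|s t [hs1 hs2] [ht1 ht2]].
  split=> [a c u v|b c u v] /=; rewrite !tliftE.
    by rewrite /kpure (gsum_linear (fun i => kpure_lin2 i a a' b')).
  rewrite /kpure /gsum scaler_sumr -big_split /=; apply: eq_bigr => i _.
  rewrite scaler_sumr -big_split /=; apply: eq_bigr => j _.
  by rewrite mulr_lin (tpure_bilin _ _).2 scalerDr !scalerA mulrC.
split=> [a c u v|b c u v] /=; rewrite !(linD (tlift_linear _)).
  by rewrite hs1 ht1 scalerDr addrACA.
by rewrite (hs2 b) (ht2 b) scalerDr addrACA.
Qed.

Definition kmul (t u : T) : T := tlift (kmul_bilin u) t.

Lemma kmul_linl u : linear (kmul^~ u).
Proof. exact: (tlift_linear (kmul_bilin u)). Qed.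

Lemma kmul_linr t : linear (kmul t).
Proof.
move=> c u v; rewrite /kmul; elim/tens_ind: t => [a b|s t hs ht].
  by rewrite !tliftE linearP.
by rewrite !(linD (tlift_linear _)) hs ht scalerDr addrACA.
Qed.

Lemma kmulE i j a (b : B) (a' : A) b' : homog i b -> homog j a' ->
  kmul (a ⊗ b) (a' ⊗ b') = (-1) ^+ (i * j) *: ((a * a') ⊗ (b * b')).
Proof. by move=> hb ha'; rewrite /kmul !tliftE; exact: kpureE. Qed.

Lemma kmulDl : left_distributive kmul +%R.
Proof. by move=> s t u; exact: (linD (kmul_linl u)). Qed.

Lemma kmulDr : right_distributive kmul +%R.
Proof. by move=> s; exact: (linD (kmul_linr s)). Qed.

Lemma kmulA : associative kmul.
Proof.
move=> s t u; elim/tens_homog_ind: s => [i1 j1 a b ha hb|s s' h h']; last first.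
  by rewrite !kmulDl h h'.
elim/tens_homog_ind: t => [i2 j2 a' b' ha' hb'|t t' h h']; last first.
  by rewrite kmulDl !kmulDr kmulDl h h'.
elim/tens_homog_ind: u => [i3 j3 a'' b'' ha'' hb''|u u' h h']; last first.
  by rewrite !kmulDr h h'.
rewrite (kmulE _ _ hb' ha'') (kmulE _ _ hb ha').
rewrite (linZ (kmul_linl _)) (linZ (kmul_linr _)).
rewrite (kmulE _ _ hb (homogM ha' ha'')) (kmulE _ _ (homogM hb hb') ha'').
rewrite !scalerA -!exprD !mulrA; congr (_ ^+ _ *: _).
by rewrite mulnDl mulnDr addnC addnA.
Qed.

Lemma kmul1l : left_id ((1 : A) ⊗ (1 : B)) kmul.
Proof.
elim/tens_homog_ind=> [i j a b ha hb|s t h h']; last by rewrite kmulDr h h'.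
by rewrite (kmulE _ _ (homog1 B) ha) !mul1r mul0n scale1r.
Qed.

Lemma kmul1r : right_id ((1 : A) ⊗ (1 : B)) kmul.
Proof.
elim/tens_homog_ind=> [i j a b ha hb|s t h h']; last by rewrite kmulDl h h'.
by rewrite (kmulE _ _ hb (homog1 A)) !mulr1 muln0 scale1r.
Qed.

HB.instance Definition _ := GRing.Zmodule_isPzRing.Build (A ⊗ B)%type
  kmulA kmul1l kmul1r kmulDl kmulDr.

Lemma tens1 : (1 : T) = (1 : A) ⊗ (1 : B).
Proof. by []. Qed.

Lemma tensM i j a (b : B) (a' : A) b' : homog i b -> homog j a' ->
  (a ⊗ b : T) * (a' ⊗ b') = (-1) ^+ (i * j) *: ((a * a') ⊗ (b * b')).
Proof. exact: kmulE. Qed.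

Lemma tens_scale_mull (c : k) (s t : T) : c *: (s * t) = (c *: s) * t.
Proof. exact: esym (linZ (kmul_linl t) c s). Qed.

Lemma tens_scale_mulr (c : k) (s t : T) : c *: (s * t) = s * (c *: t).
Proof. exact: esym (linZ (kmul_linr s) c t). Qed.

Definition tcomp (n : nat) (t : T) : T :=
  \sum_(i < n.+1) tmap (@gcomp k A i) (@gcomp k B (n - i)%N) t.

Lemma tcomp_lin n : linear (tcomp n).
Proof.
move=> c s t; rewrite /tcomp scaler_sumr -big_split /=.
by apply: eq_bigr => i _; rewrite linearP.
Qed.

Lemma tcompE n i j (a : A) (b : B) : homog i a -> homog j b ->
  tcomp n (a ⊗ b) = if n == (i + j)%N then a ⊗ b else 0.
Proof.
move=> ha hb; rewrite /tcomp.
have tp0 (m : A) (n' : B) : m ⊗ (0 : B) = 0 /\ (0 : A) ⊗ n' = 0.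
  by rewrite (lin0 ((tpure_bilin _ _).1 m)) (lin0 ((tpure_bilin _ _).2 n')).
under eq_bigr do rewrite tmapE /= (homogP _ ha) (homogP _ hb).
have [hin|hin] := ltnP i n.+1.
  rewrite (bigD1 (Ordinal hin)) //= eqxx big1 ?addr0.
    rewrite -(eqn_add2l i) subnKC //; case: eqP => // _.
    by rewrite (tp0 a b).1.
  by move=> l; rewrite -val_eqE /= => /negPf ->; rewrite (tp0 a _).2.
rewrite big1 => [|l _]; last first.
  by rewrite ltn_eqF ?(tp0 a _).2 // (leq_trans (ltn_ord l)).
by rewrite ltn_eqF // ltn_addr.
Qed.

Lemma tcompK m n t : tcomp m (tcomp n t) = if m == n then tcomp n t else 0.
Proof.
elim/tens_homog_ind: t => [i j a b ha hb|s t hs ht]; last first.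
  by rewrite !(linD (tcomp_lin _)) hs ht; case: eqP; rewrite ?addr0.
rewrite (tcompE _ ha hb); case: eqP => [->|_]; last first.
  by rewrite (lin0 (tcomp_lin _)) if_same.
by rewrite (tcompE _ ha hb).
Qed.

Lemma tcomp_sum t : exists N : nat, t = \sum_(i < N) tcomp i t.
Proof.
suff [N /(_ N (leqnn N))] : fsum tcomp t by exists N.
elim/tens_homog_ind: t => [i j a b ha hb|s t]; last exact: fsumD tcomp_lin _ _.
by apply: (fsum_homog tcompK (n := (i + j)%N)); rewrite (tcompE _ ha hb) eqxx.
Qed.

Lemma tcomp1 : tcomp 0 (1 : T) = 1.
Proof. by rewrite tens1 (tcompE _ (homog1 A) (homog1 B)). Qed.

Lemma tcompM m n (s t : T) :
  tcomp (m + n)%N (tcomp m s * tcomp n t) = tcomp m s * tcomp n t.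
Proof.
elim/tens_homog_ind: s => [i j a b ha hb|s s' h h']; last first.
  by rewrite (linD (tcomp_lin _)) mulrDl (linD (tcomp_lin _)) h h'.
elim/tens_homog_ind: t => [i' j' a' b' ha' hb'|t t' h h']; last first.
  by rewrite (linD (tcomp_lin n)) mulrDr (linD (tcomp_lin _)) h h'.
rewrite (tcompE _ ha hb) (tcompE _ ha' hb').
case: eqP => [->|_]; last by rewrite mul0r (lin0 (tcomp_lin _)).
case: eqP => [->|_]; last by rewrite mulr0 (lin0 (tcomp_lin _)).
rewrite (tensM _ _ hb ha') (linZ (tcomp_lin _)).
by rewrite (tcompE _ (homogM ha ha') (homogM hb hb')) addnACA eqxx.
Qed.

HB.instance Definition _ := isGradedAlgebra.Build k (A ⊗ B)%type
  kmulA kmul1l kmul1r kmulDl kmulDr tens_scale_mull tens_scale_mulr tcomp_lin tcompK tcomp_sum tcomp1 tcompM.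

End Koszul.

(* op x y is the rack operation, written x^y below. *)
Record is_rack (X : Type) (op : X -> X -> X) : Prop := IsRack {
  rack_nonempty : inhabited X;
  rack_bij : forall y, bijective (op^~ y);
  rack_dist : forall x y z, op (op x y) z = op (op x z) (op y z)
}.

(* The k-algebra on generators x, e_x with relations y x^y = x y and
   y e_(x^y) = e_x y. *)
Inductive rack_gen (X : Type) : Type :=
| GX of X
| GE of X.

Inductive rack_rel (k X : Type) (op : X -> X -> X) :
    term k (rack_gen X) -> term k (rack_gen X) -> Prop :=
| rack_rel_x x y : rack_rel op
    (Mul (Gen (GX y)) (Gen (GX (op x y)))) (Mul (Gen (GX x)) (Gen (GX y)))
| rack_rel_e x y : rack_rel op
    (Mul (Gen (GX y)) (Gen (GE (op x y)))) (Mul (Gen (GE x)) (Gen (GX y))).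

Definition rack_alg (k : comPzRingType) (X : Type) (op : X -> X -> X) : Type :=
  palg (@rack_rel k X op).

Section Convolution.
Variable R : pzRingType.
Implicit Types u v w : nat -> R.

Definition conv u v n := \sum_(i < n.+1) u i * v (n - i)%N.

Lemma conv_rev u v n : conv u v n = \sum_(i < n.+1) u (n - i)%N * v i.
Proof.
rewrite /conv (reindex_inj rev_ord_inj) /=.
by apply: eq_bigr => i _; rewrite (sub_ordK i).
Qed.

Lemma conv_ext u u' v v' n : u =1 u' -> v =1 v' -> conv u v n = conv u' v' n.
Proof. by move=> hu hv; apply: eq_bigr => i _; rewrite hu hv. Qed.

Lemma convA u v w n : conv u (conv v w) n = conv (conv u v) w n.
Proof.
rewrite [RHS]conv_rev [LHS]/conv.
pose c3 j l := u j * (v (n - j - l)%N * w l).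
transitivity (\sum_(j < n.+1) \sum_(l < n.+1 | (l <= n - j)%N) c3 j l).
  apply: eq_bigr => /= j _; rewrite conv_rev big_distrr /=.
  by rewrite (big_ord_narrow_leq (leq_subr _ _)).
rewrite (exchange_big_dep predT) //=; apply: eq_bigr => l _.
transitivity (\sum_(j < n.+1 | (j <= n - l)%N) c3 j l).
  apply: eq_bigl => j; rewrite -ltnS -(ltnS j) -!subSn ?leq_ord //.
  by rewrite -subn_gt0 -(subn_gt0 j) -!subnDA addnC.
rewrite (big_ord_narrow_leq (leq_subr _ _)) /conv big_distrl /=.
by apply: eq_bigr => j _; rewrite /c3 -!subnDA addnC mulrA.
Qed.

Lemma convDl u u' v n : conv (fun i => u i + u' i) v n = conv u v n + conv u' v n.
Proof. by rewrite -big_split /=; apply: eq_bigr => i _; rewrite mulrDl. Qed.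

Lemma convDr u v v' n : conv u (fun i => v i + v' i) n = conv u v n + conv u v' n.
Proof. by rewrite -big_split /=; apply: eq_bigr => i _; rewrite mulrDr. Qed.

Definition concentrated (m : nat) (a : R) : nat -> R :=
  fun n => if n == m then a else 0.

Lemma conv_concl m a v n :
  conv (concentrated m a) v n = if (m <= n)%N then a * v (n - m)%N else 0.
Proof.
rewrite /conv /concentrated; case: leqP => h; last first.
  by rewrite big1 // => i _; rewrite ltn_eqF ?mul0r // (leq_trans (ltn_ord i)).
have h' : (m < n.+1)%N by rewrite ltnS.
rewrite (bigD1 (Ordinal h')) //= eqxx big1 ?addr0 // => i.
by rewrite -val_eqE /= => /negPf ->; rewrite mul0r.
Qed.

Lemma conv_conc m m' a b :
  conv (concentrated m a) (concentrated m' b) =1 concentrated (m + m') (a * b).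
Proof.
move=> n; rewrite conv_concl /concentrated.
case: leqP => h; first by rewrite -(eqn_add2l m) subnKC //; case: eqP; rewrite ?mulr0.
by rewrite ltn_eqF // ltn_addr.
Qed.

End Convolution.

Section RackAlgebra.
Variables (k : comPzRingType) (X : Type) (op : X -> X -> X).
Local Notation B := (rack_alg k op).
Local Notation cls := (@pcls k (rack_gen X) (rack_rel op)).
Local Notation tm := (term k (rack_gen X)).

HB.instance Definition _ := GRing.PzRing.on B.
HB.instance Definition _ := GRing.Lmodule.on B.

Definition genX (x : X) : B := cls (Gen (GX x)).
Definition genE (x : X) : B := cls (Gen (GE x)).

Lemma genX_rel x y : genX y * genX (op x y) = genX x * genX y.
Proof.
rewrite -[LHS]pclsM -[RHS]pclsM; apply/pcls_eq/pc_rel; exact: rack_rel_x.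
Qed.

Lemma genE_rel x y : genX y * genE (op x y) = genE x * genX y.
Proof.
rewrite -[LHS]pclsM -[RHS]pclsM; apply/pcls_eq/pc_rel; exact: rack_rel_e.
Qed.

Definition gen_deg (g : rack_gen X) : nat :=
  match g with GX _ => 0 | GE _ => 1 end.

(* The component of degree n of the class of a term. *)
Fixpoint term_comp (s : tm) : nat -> B :=
  match s with
  | Gen g => concentrated (gen_deg g) (cls (Gen g) : B)
  | Zero => fun=> 0
  | One => concentrated 0%N (1 : B)
  | Add s t => fun n => term_comp s n + term_comp t n
  | Mul s t => conv (term_comp s) (term_comp t)
  | Scale c s => fun n => c *: term_comp s n
  end.

Lemma rack_scaleAl (c : k) (a b : B) : c *: (a * b) = (c *: a) * b.
Proof. exact: pscalerAl. Qed.
Lemma rack_scaleAr (c : k) (a b : B) : c *: (a * b) = a * (c *: b).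
Proof. exact: pscalerAr. Qed.

Lemma term_comp_congr s t :
  pcongr (rack_rel op) s t -> term_comp s =1 term_comp t.
Proof.
elim=> {s t} //=.
- move=> s t [x y|x y] n /=; rewrite !conv_conc; congr (concentrated _ _ n).
    exact: genX_rel.
  exact: genE_rel.
- by move=> s t _ IH n; rewrite IH.
- by move=> s t u _ IH _ IH' n; rewrite IH IH'.
- by move=> s s' t t' _ IH _ IH' n; rewrite IH IH'.
- by move=> s s' t t' _ IH _ IH' n; apply: conv_ext.
- by move=> c s s' _ IH n; rewrite IH.
- by move=> s t u n; rewrite addrA.
- by move=> s t n; rewrite addrC.
- by move=> s n; rewrite add0r.
- by move=> s n; rewrite scaleN1r addNr.
- by move=> c c' s n; rewrite scalerA.
- by move=> s n; rewrite scale1r.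
- by move=> c s t n; rewrite scalerDr.
- by move=> c c' s n; rewrite scalerDl.
- by move=> s t u n; rewrite convA.
- by move=> s n; rewrite conv_concl mul1r subn0.
- move=> s n; rewrite conv_rev big_ord_recl /= /concentrated /= subn0 mulr1.
  by rewrite big1 ?addr0 // => i _; rewrite mulr0.
- by move=> s t u n; rewrite convDl.
- by move=> s t u n; rewrite convDr.
- move=> c s t n; rewrite /conv scaler_sumr.
  by apply: eq_bigr => i _; rewrite rack_scaleAl.
- move=> c s t n; rewrite /conv scaler_sumr.
  by apply: eq_bigr => i _; rewrite rack_scaleAr.
Qed.

Definition rcomp (n : nat) (b : B) : B := term_comp (prep b) n.

Lemma rcompE n s : rcomp n (cls s) = term_comp s n.
Proof. exact/term_comp_congr/prep_pcls. Qed.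

Lemma rcomp_lin n : linear (rcomp n).
Proof.
move=> c a b; rewrite -[a]prepK -[b]prepK.
have -> : c *: (cls (prep a) : B) + cls (prep b) = cls (Add (Scale c (prep a)) (prep b)).
  by rewrite pclsD pclsZ.
by rewrite !rcompE.
Qed.

Lemma rcompM n (a b : B) :
  rcomp n (a * b) = conv (rcomp^~ a) (rcomp^~ b) n.
Proof.
rewrite -[a]prepK -[b]prepK.
have -> : (cls (prep a) : B) * cls (prep b) = cls (Mul (prep a) (prep b)).
  by rewrite pclsM.
by rewrite rcompE /=; apply: conv_ext => i; rewrite rcompE.
Qed.

Lemma rcomp1 n : rcomp n 1 = concentrated 0%N 1 n.
Proof. by rewrite (rcompE n One). Qed.

Lemma rcomp_mulh m n (a b : B) : rcomp^~ a =1 concentrated m a ->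
  rcomp^~ b =1 concentrated n b -> rcomp^~ (a * b) =1 concentrated (m + n) (a * b).
Proof. by move=> ha hb i; rewrite rcompM (conv_ext _ ha hb) conv_conc. Qed.

Lemma rcompK_conc n (a : B) : rcomp^~ (rcomp n a) =1 concentrated n (rcomp n a).
Proof.
have r0 m : rcomp m 0 = 0 by exact: lin0 (rcomp_lin m).
rewrite -[a]prepK rcompE.
elim: (prep a) n => [g|||s IHs t IHt|s IHs t IHt|c s IHs] n m /=.
- rewrite /concentrated; case: (n =P gen_deg g) => [->|_].
    by rewrite rcompE.
  by rewrite r0 if_same.
- by rewrite r0 /concentrated if_same.
- rewrite [X in rcomp m X]/concentrated [X in concentrated n X]/concentrated.
  case: eqP => [->|_]; first exact: rcomp1.
  by rewrite r0 /concentrated if_same.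
- rewrite (linD (rcomp_lin m)) IHs IHt /concentrated.
  by case: eqP; rewrite ?addr0.
- rewrite (lin_sum (rcomp_lin m)) /concentrated; case: eqP => [->|/eqP hm].
    apply: eq_bigr => i _.
    by rewrite (rcomp_mulh (IHs _) (IHt _)) /concentrated subnKC ?eqxx // -ltnS.
  rewrite big1 // => i _; rewrite (rcomp_mulh (IHs _) (IHt _)) /concentrated.
  by rewrite subnKC ?(negPf hm) // -ltnS.
- rewrite (linZ (rcomp_lin m)) IHs /concentrated.
  by case: eqP; rewrite ?scaler0.
Qed.

Lemma rcompK m n a : rcomp m (rcomp n a) = if m == n then rcomp n a else 0.
Proof. exact: rcompK_conc. Qed.

Lemma rcomp_gone : rcomp 0 1 = 1.
Proof. exact: rcomp1. Qed.

Lemma rcomp_gmul m n a b :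
  rcomp (m + n) (rcomp m a * rcomp n b) = rcomp m a * rcomp n b.
Proof.
by rewrite (rcomp_mulh (rcompK_conc m a) (rcompK_conc n b)) /concentrated eqxx.
Qed.

Lemma rcomp_sum a : exists N : nat, a = \sum_(i < N) rcomp i a.
Proof.
suff [N /(_ N (leqnn N))] : fsum rcomp a by exists N.
have hom m (b : B) : rcomp m b = b -> fsum rcomp b.
  by move=> hb; exact: (fsum_homog rcompK hb).
have f0 : fsum rcomp (0 : B) by exact: fsum0 rcomp_lin rcompK.
have fD (b b' : B) : fsum rcomp b -> fsum rcomp b' -> fsum rcomp (b + b').
  exact: fsumD rcomp_lin b b'.
have gen_fsum (g : rack_gen X) : fsum rcomp (cls (Gen g) : B).
  by apply: (hom (gen_deg g)); rewrite rcompE /= /concentrated eqxx.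
rewrite -[a]prepK; elim: (prep a) => [g|||s IHs t IHt|s IHs t IHt|c s IHs].
- exact: gen_fsum.
- exact: f0.
- exact: (hom 0%N _ rcomp_gone).
- by rewrite pclsD; exact: fD.
- rewrite pclsM; have [N hN] := IHs; have [N' hN'] := IHt.
  rewrite [X in X * _](hN N) // [X in _ * X](hN' N') // big_distrl /=.
  elim/big_ind: _ => [|b b'|i _]; [exact: f0|exact: fD|].
  rewrite big_distrr /=.
  elim/big_ind: _ => [|b b'|j _]; [exact: f0|exact: fD|].
  exact: hom (rcomp_gmul i j _ _).
- rewrite pclsZ; have [N hN] := IHs; exists N => M hM.
  rewrite [in LHS](hN M hM) scaler_sumr; apply: eq_bigr => i _.
  by rewrite (linZ (rcomp_lin i)).
Qed.

HB.instance Definition _ := isGradedAlgebra.Build k B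
  (@mulrA B) (@mul1r B) (@mulr1 B) (@mulrDl B) (@mulrDr B)
  rack_scaleAl rack_scaleAr rcomp_lin rcompK rcomp_sum rcomp_gone rcomp_gmul.

Lemma genX_homog x : homog 0 (genX x).
Proof. by rewrite /homog /gcomp /= (rcompE 0). Qed.

Lemma genE_homog x : homog 1 (genE x).
Proof. by rewrite /homog /gcomp /= (rcompE 1). Qed.

End RackAlgebra.

Section DGBialgebra.
Variable k : comPzRingType.

Definition graded_alg_morphism (A B : gradedAlgType k) (f : {linear A -> B}) : Prop :=
  monoid_morphism f /\ (forall n (a : A), homog n a -> homog n (f a)).

Variable A : gradedAlgType k.

(* Degree -1: A_(n+1) is mapped into A_n, and A_0 to 0. *)
Definition super_derivation (d : {linear A -> A}) : Prop :=
  [/\ forall n (a : A), homog n.+1 a -> homog n (d a),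
      forall a : A, homog 0 a -> d a = 0
    & forall n (a b : A), homog n a -> d (a * b) = d a * b + (-1) ^+ n *: (a * d b)].

(* tmap gsign d is the map 1 (x) d with its Koszul sign,
   a (x) b |-> (-1)^|a| a (x) d b. *)
Definition super_coderivation (Delta : {linear A -> (A ⊗ A)%type}) (d : {linear A -> A}) : Prop :=
  forall a, Delta (d a) = tmap d idfun (Delta a) + tmap gsign d (Delta a).

Definition coassociative (Delta : {linear A -> (A ⊗ A)%type}) : Prop :=
  forall a, tassoc (tmap Delta idfun (Delta a)) = tmap idfun Delta (Delta a).

Definition is_counit (Delta : {linear A -> (A ⊗ A)%type}) (eps : {linear A -> k^o}) : Prop :=
  forall a, tunitl (tmap eps idfun (Delta a)) = a /\
            tunitr (tmap idfun eps (Delta a)) = a.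

(* The multiplication, the unit and their compatibility with the grading are
   part of gradedAlgType. *)
Record dg_bialgebra (d : {linear A -> A}) (Delta : {linear A -> (A ⊗ A)%type}) : Prop := {
  dgb_Delta : graded_alg_morphism Delta;
  dgb_coassoc : coassociative Delta;
  dgb_counit : exists eps : {linear A -> k^o},
    [/\ is_counit Delta eps, monoid_morphism eps
      & forall n (a : A), homog n.+1 a -> eps a = 0];
  dgb_d2 : forall a, d (d a) = 0;
  dgb_der : super_derivation d;
  dgb_coder : super_coderivation Delta d
}.

End DGBialgebra.

Section RackDGBialgebra.
Variables (k : comPzRingType) (X : Type) (op : X -> X -> X).
Local Notation B := (rack_alg k op).
Local Notation genX := (@genX k X op).
Local Notation genE := (@genE k X op).

Definition is_rack_d (d : {linear B -> B}) : Prop :=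
  super_derivation d /\ (forall x, d (genE x) = 1 - genX x /\ d (genX x) = 0).

Definition is_rack_Delta (Delta : {linear B -> (B ⊗ B)%type}) : Prop :=
  graded_alg_morphism Delta /\
  (forall x, Delta (genX x) = genX x ⊗ genX x /\
             Delta (genE x) = genE x ⊗ genX x + (1 : B) ⊗ genE x).

End RackDGBialgebra.

(* Main.v *)
From HB Require Import structures.
Require Import Defs.
From mathcomp Require Import all_boot all_algebra.
From mathcomp Require Import zify.

(** A homomorphism out of an algebra given by generators and relations is a
    choice of images of the generators that respects the relations
    ([palg_lift]), so each structure map reduces to a check on the two families
    of relations.

    - The comultiplication is a homomorphism into B ⊗ B with its Koszul-signed
      product, and the counit x |-> 1, e_x |-> 0 is one into k.
    - A super-derivation d is not a homomorphism, but a |-> (a, d a) is one into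
      the square-zero extension of B by the bimodule B whose left action is
      twisted by the grading involution: its product
      (a, u)(b, v) = (ab, ub + (-1)^|a| av) encodes the signed Leibniz rule.

    Of the identities to prove, those between homomorphisms (coassociativity,
    counit, uniqueness of Delta) hold as soon as they hold on generators
    ([rack_morphism_ext]); for this the reassociation isomorphism, the tensor
    product of graded homomorphisms and the contractions with the counit must be
    multiplicative for the Koszul products.  The identities on d (uniqueness,
    d^2 = 0, coderivation) are not between homomorphisms, but they too pass to
    products of homogeneous elements: the square of a super-derivation is an
    ordinary derivation ([super_derivation_sqrM]), and d ⊗ 1 + 1 ⊗ d is a
    super-derivation of B ⊗ B ([tens_derM]), so Delta d and (d ⊗ 1 + 1 ⊗ d) Delta
    obey the same Leibniz rule along Delta.  The induction that propagates such
    statements from the generators is [rack_homog_ind]. *)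

Set Implicit Arguments.
Unset Strict Implicit.
Unset Printing Implicit Defensive.

Import GRing.Theory.
Local Open Scope ring_scope.

(** * Homomorphisms out of a presented algebra *)

Section PresentedLift.
Variables (k : comPzRingType) (G : Type) (R : term k G -> term k G -> Prop).
Variables (T : lmodType k) (one : T) (mul : T -> T -> T) (f : G -> T).

Fixpoint alg_eval (s : term k G) : T :=
  match s with
  | Gen g => f g
  | Zero => 0
  | One => one
  | Add s t => alg_eval s + alg_eval t
  | Mul s t => mul (alg_eval s) (alg_eval t)
  | Scale c s => c *: alg_eval s
  end.

Hypotheses (mulA : associative mul) (mul1t : left_id one mul)
  (mult1 : right_id one mul) (mul_bilin : bilin mul).
Hypothesis f_rel : forall s t, R s t -> alg_eval s = alg_eval t.

Lemma alg_eval_congr s t : pcongr R s t -> alg_eval s = alg_eval t.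
Proof.
have [linr linl] := mul_bilin.
elim=> //= *; rewrite ?addrA ?add0r ?scaleN1r ?addNr ?scalerA ?scale1r ?scalerDr
  ?scalerDl ?mul1t ?mult1 ?(linD (linr _)) ?(linD (linl _))
  ?(linZ (linr _)) ?(linZ (linl _)) //; try congruence.
- exact: addrC.
Qed.

(** The target is a bare module with a product, so that one statement serves the
    tensor square of a graded algebra, the base ring and the square-zero
    extension that produces derivations. *)
Lemma palg_lift : exists F : palg R -> T,
  [/\ linear F, F 1 = one, forall a b, F (a * b) = mul (F a) (F b)
    & forall g, F (pcls R (Gen g)) = f g].
Proof.
pose F (a : palg R) := alg_eval (prep a).
have FE s : F (pcls R s) = alg_eval s by exact/alg_eval_congr/prep_pcls.
exists F; split=> [c|||g]; last exact: FE.
- by elim/palgW=> s; elim/palgW=> t; rewrite -pclsZ -pclsD !FE.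
- exact: (FE One).
- by elim/palgW=> s; elim/palgW=> t; rewrite -pclsM !FE.
Qed.

End PresentedLift.

(** * Koszul-signed tensor products *)

Section TensorPure.
Variables (k : comPzRingType) (M N : lmodType k).

Lemma tpureDl (m m' : M) (n : N) : (m + m') ⊗ n = m ⊗ n + m' ⊗ n.
Proof. exact: (linD ((tpure_bilin M N).2 n)). Qed.

Lemma tpureDr (m : M) (n n' : N) : m ⊗ (n + n') = m ⊗ n + m ⊗ n'.
Proof. exact: (linD ((tpure_bilin M N).1 m)). Qed.

Lemma tpureZl c (m : M) (n : N) : (c *: m) ⊗ n = c *: (m ⊗ n).
Proof. exact: (linZ ((tpure_bilin M N).2 n)). Qed.

Lemma tpureZr c (m : M) (n : N) : m ⊗ (c *: n) = c *: (m ⊗ n).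
Proof. exact: (linZ ((tpure_bilin M N).1 m)). Qed.

Lemma tpure0l (n : N) : (0 : M) ⊗ n = 0.
Proof. exact: (lin0 ((tpure_bilin M N).2 n)). Qed.

Lemma tpure0r (m : M) : m ⊗ (0 : N) = 0.
Proof. exact: (lin0 ((tpure_bilin M N).1 m)). Qed.

End TensorPure.

Section GradedFacts.
Variable k : comPzRingType.
Implicit Types A B C : gradedAlgType k.

Lemma homog_tpure A B i j (a : A) (b : B) :
  homog i a -> homog j b -> homog (i + j) (a ⊗ b).
Proof. by move=> ha hb; rewrite /homog /gcomp /= (tcompE _ ha hb) eqxx. Qed.

Lemma gsignM A (a b : A) : gsign (a * b) = gsign a * gsign b.
Proof.
elim/homog_ind: a => [m a ha|a a' h h']; last by rewrite mulrDl !linearD /= mulrDl h h'.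
elim/homog_ind: b => [n b hb|b b' h h']; last by rewrite mulrDr !linearD /= mulrDr h h'.
rewrite (gsignE (homogM ha hb)) (gsignE ha) (gsignE hb).
by rewrite -scale_mull -scale_mulr scalerA exprD.
Qed.

Lemma gsign1 A : gsign (1 : A) = 1.
Proof. by rewrite (gsignE (homog1 A)) scale1r. Qed.

Lemma id_morphism A : graded_alg_morphism (idfun : {linear A -> A}).
Proof. by []. Qed.

(** Both factors must preserve degrees, since the Koszul sign of a product is
    computed from them. *)
Lemma tmap_morphism A B A' B' (f : {linear A -> A'}) (g : {linear B -> B'}) :
  graded_alg_morphism f -> graded_alg_morphism g -> monoid_morphism (tmap f g).
Proof.
move=> [[f1 fM] fh] [[g1 gM] gh]; split; first by rewrite !tens1 tmapE f1 g1.
move=> s t; elim/tens_homog_ind: s => [i j a b ha hb|s s' h h']; last first.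
  by rewrite mulrDl !linearD /= mulrDl h h'.
elim/tens_homog_ind: t => [i' j' a' b' ha' hb'|t t' h h']; last first.
  by rewrite mulrDr !linearD /= mulrDr h h'.
rewrite (tensM _ _ hb ha') linearZ /= !tmapE fM gM.
by rewrite (tensM _ _ (gh _ _ hb) (fh _ _ ha')).
Qed.

Lemma tens3_homog_ind A B C (P : ((A ⊗ B) ⊗ C)%type -> Prop) :
    (forall i j l (a : A) (b : B) (c : C), homog i a -> homog j b -> homog l c ->
       P (a ⊗ b ⊗ c)) ->
    (forall s t, P s -> P t -> P (s + t)) -> forall t, P t.
Proof.
move=> hP hD; apply: tens_ind => // s c.
elim/tens_homog_ind: s => [i j a b ha hb|s s' h h']; last first.
  by rewrite tpureDl; exact: hD.
elim/homog_ind: c => [l c hc|c c' h h']; first exact: hP ha hb hc.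
by rewrite tpureDr; exact: hD.
Qed.

(** Either bracketing of a product of two triple tensors yields the sign of
    exponent |b||a'| + |c||a'| + |c||b'|. *)
Lemma tassoc_morphism A B C : monoid_morphism (@tassoc k A B C).
Proof.
split; first by rewrite !tens1 tassocE.
move=> s t; elim/tens3_homog_ind: s => [i j l a b c ha hb hc|s s' h h']; last first.
  by rewrite mulrDl !linearD /= mulrDl h h'.
elim/tens3_homog_ind: t => [i' j' l' a' b' c' ha' hb' hc'|t t' h h']; last first.
  by rewrite mulrDr !linearD /= mulrDr h h'.
rewrite (tensM _ _ hc (homog_tpure ha' hb')) (tensM _ _ hb ha').
rewrite !tassocE (tensM _ _ (homog_tpure hb hc) ha') (tensM _ _ hc hb').
rewrite tpureZl tpureZr !linearZ /= tassocE !scalerA -!exprD.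
by congr (_ ^+ _ *: _); rewrite mulnDl mulnDr; lia.
Qed.

Section Augmentation.
Variables (A : gradedAlgType k) (eps : {linear A -> k^o}).
Hypotheses (epsM : monoid_morphism eps)
  (eps_pos : forall n (a : A), homog n.+1 a -> eps a = 0).

(** Koszul signs are invisible after contracting with an augmentation: a factor
    of positive degree on the contracted side is sent to 0, and one of degree 0
    produces no sign. *)
Lemma tunitl_augM (s t : (A ⊗ A)%type) : tunitl (tmap eps idfun (s * t)) =
  tunitl (tmap eps idfun s) * tunitl (tmap eps idfun t).
Proof.
elim/tens_homog_ind: s => [i j u v hu hv|s s' h h']; last first.
  by rewrite mulrDl !linearD /= mulrDl h h'.
elim/tens_homog_ind: t => [i' j' u' v' hu' hv'|t t' h h']; last first.
  by rewrite mulrDr !linearD /= mulrDr h h'.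
rewrite (tensM _ _ hv hu') !linearZ /= !tmapE !tunitlE /= epsM.2.
rewrite -scale_mull -scale_mulr scalerA.
case: i' hu' => [|i'] hu'; first by rewrite muln0 scale1r.
by rewrite (eps_pos hu') mulr0 scale0r scaler0.
Qed.

Lemma tunitr_augM (s t : (A ⊗ A)%type) : tunitr (tmap idfun eps (s * t)) =
  tunitr (tmap idfun eps s) * tunitr (tmap idfun eps t).
Proof.
elim/tens_homog_ind: s => [i j u v hu hv|s s' h h']; last first.
  by rewrite mulrDl !linearD /= mulrDl h h'.
elim/tens_homog_ind: t => [i' j' u' v' hu' hv'|t t' h h']; last first.
  by rewrite mulrDr !linearD /= mulrDr h h'.
rewrite (tensM _ _ hv hu') !linearZ /= !tmapE !tunitrE /= epsM.2.
rewrite -scale_mull -scale_mulr scalerA.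
case: j hv => [|j] hv; first by rewrite mul0n scale1r.
by rewrite (eps_pos hv) mul0r scale0r scaler0.
Qed.

End Augmentation.
End GradedFacts.

(** * Super-derivations and tensor squares *)

Lemma sign_parity (R : pzRingType) m n : odd m = odd n -> (-1) ^+ m = (-1) ^+ n :> R.
Proof. by move=> h; rewrite -signr_odd h signr_odd. Qed.

Section SuperDerivation.
Variables (k : comPzRingType) (A : gradedAlgType k) (d : {linear A -> A}).
Hypothesis d_der : super_derivation d.

Lemma super_derivation1 : d 1 = 0.
Proof. by have [_ d0 _] := d_der; exact/d0/homog1. Qed.

(** The two cross terms carry the signs (-1)^(|a|-1) and (-1)^|a| and cancel. *)
Lemma super_derivation_sqrM m (a b : A) : homog m a ->
  d (d (a * b)) = d (d a) * b + a * d (d b).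
Proof.
have [dS d0 dM] := d_der; case: m => [|m] hm; rewrite (dM _ _ _ hm) linearD linearZ /=.
  by rewrite (d0 _ hm) linear0 !mul0r linear0 !add0r (dM _ _ _ hm) d0 // mul0r add0r !scale1r.
rewrite (dM _ _ _ (dS _ _ hm)) (dM _ _ _ hm) scalerDr scalerA -exprD.
(* The two middle terms are opposite multiples of d a * d b. *)
rewrite -addrA; congr (_ + _); rewrite addrA -scalerDl exprS mulN1r addrN scale0r add0r.
by rewrite -signr_odd oddD addbb scale1r.
Qed.

End SuperDerivation.

Section TensorDerivation.
Variables (k : comPzRingType) (A : gradedAlgType k) (d : {linear A -> A}).
Hypothesis d_der : super_derivation d.
Local Notation T := (A ⊗ A)%type.

Definition tens_der (t : T) : T := tmap d idfun t + tmap gsign d t.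

Lemma tens_der_linear : linear tens_der.
Proof. by move=> c s t; rewrite /tens_der !linearP /= addrACA scalerDr. Qed.

(** The Koszul sign for a factor [d b] of degree |b| - 1 is written with the
    exponent |b||a'| + |a'|, of the same parity as (|b| - 1)|a'|; this avoids a
    truncated subtraction when |b| = 0, where [d b = 0]. *)
Lemma tensM_dl i j (a b a' b' : A) : homog j b -> homog i a' ->
  (a ⊗ d b : T) * (a' ⊗ b') = (-1) ^+ (j * i + i) *: ((a * a') ⊗ (d b * b')).
Proof.
have [dS d0 _] := d_der; case: j => [|j] hb ha'.
  by rewrite (d0 _ hb) mul0r !tpure0r mul0r scaler0.
rewrite (tensM _ _ (dS _ _ hb) ha'); congr (_ *: _); apply: sign_parity; lia.
Qed.

Lemma tensM_dr i j (a b a' b' : A) : homog j b -> homog i a' ->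
  (a ⊗ b : T) * (d a' ⊗ b') = (-1) ^+ (j * i + j) *: ((a * d a') ⊗ (b * b')).
Proof.
have [dS d0 _] := d_der; case: i => [|i] hb ha'.
  by rewrite (d0 _ ha') mulr0 !tpure0l mulr0 scaler0.
rewrite (tensM _ _ hb (dS _ _ ha')); congr (_ *: _); apply: sign_parity; lia.
Qed.

(** The Leibniz rule of d, applied in each slot, gives four terms on pure tensors;
    moving d past b or past a' costs exactly the Koszul signs of the product. *)
Lemma tens_derM n (s t : T) : homog n s ->
  tens_der (s * t) = tens_der s * t + (-1) ^+ n *: (s * tens_der t).
Proof.
have [_ _ dM] := d_der; move=> hs.
(* A decomposition of s into pure tensors need not be homogeneous of degree n
   term by term, so the sign is traded for the linear grading involution. *)
rewrite scale_mull -(gsignE hs) {n hs}.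
have derE a b : tens_der (a ⊗ b) = d a ⊗ b + gsign a ⊗ d b by rewrite /tens_der !tmapE.
(* Only these rules for tens_der are used; it is made opaque because it unfolds
   to a sum that distributivity would expand. *)
move: tens_der (linD tens_der_linear) (linZ tens_der_linear) derE => D DD DZ DE.
elim/tens_homog_ind: s => [i j a b ha hb|s s' h h']; last first.
  by rewrite mulrDl !DD linearD /= !mulrDl h h' addrACA.
elim/tens_homog_ind: t => [i' j' a' b' ha' hb'|t t' h h']; last first.
  by rewrite mulrDr !DD !mulrDr h h' addrACA.
rewrite (tensM _ _ hb ha') DZ (gsignE (homog_tpure ha hb)) !DE.
rewrite (gsignE (homogM ha ha')) (gsignE ha) (gsignE ha').
rewrite (dM _ _ _ ha) (dM _ _ _ hb) mulrDl !mulrDr !tpureZl.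
rewrite -!scale_mull -!scale_mulr (tensM_dl _ _ hb ha') (tensM_dr _ _ hb ha').
rewrite (tensM _ _ hb ha') (tensM _ _ hb ha').
rewrite tpureDl tpureDr !tpureZl !tpureZr !scalerDr !scalerA -!exprD.
rewrite [RHS]addrACA; congr (_ + _ *: _ + (_ *: _ + _ *: _)); apply: sign_parity; lia.
Qed.

End TensorDerivation.

(** * Induction and homomorphisms on the rack algebra *)

Section RackAlgebra.
Variables (k : comPzRingType) (X : Type) (op : X -> X -> X).
Local Notation B := (rack_alg k op).
Local Notation genX := (@genX k X op).
Local Notation genE := (@genE k X op).

(** A homogeneous element is a combination of products of generators of the same
    total degree; hence homogeneous factors may be assumed in the product step; the
    signed Leibniz rule is only available for those. *)
Lemma rack_homog_ind (P : nat -> B -> Prop) :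
    (forall n, P n 0) -> P 0 1 -> (forall x, P 0 (genX x)) -> (forall x, P 1 (genE x)) ->
    (forall n a b, P n a -> P n b -> P n (a + b)) ->
    (forall n (c : k) a, P n a -> P n (c *: a)) ->
    (forall m n (a b : B), homog m a -> homog n b -> P m a -> P n b -> P (m + n)%N (a * b)) ->
  forall n a, homog n a -> P n a.
Proof.
move=> P0 P1 PX PE PD PZ PM n a <-.
rewrite /gcomp /= -[a]prepK rcompE.
have hc s i : homog i (term_comp op s i : B) by rewrite -rcompE; exact: homog_gcomp.
have Pc m b i : P m b -> P i (concentrated m b i).
  by rewrite /concentrated; case: eqP => [->|].
elim: (prep a) n => [[x|x]|||s IHs t IHt|s IHs t IHt|c s IHs] n /=.
- exact/Pc/PX.
- exact/Pc/PE.
- exact: P0.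
- exact: Pc.
- exact: PD.
- rewrite /conv; elim/big_ind: _ => [|b b'|i _]; [exact: P0|exact: PD|].
  suff : P (i + (n - i))%N (term_comp op s i * term_comp op t (n - i)).
    by rewrite subnKC // -ltnS.
  exact: PM.
- exact: PZ.
Qed.

Lemma rack_ind (P : B -> Prop) :
    P 1 -> (forall x, P (genX x)) -> (forall x, P (genE x)) ->
    (forall a b, P a -> P b -> P (a + b)) -> (forall (c : k) a, P a -> P (c *: a)) ->
    (forall a b, P a -> P b -> P (a * b)) ->
  forall a, P a.
Proof.
move=> P1 PX PE PD PZ PM a; elim/homog_ind: a => [n a|a b]; last exact: PD.
apply: (rack_homog_ind (P := fun _ => P)) => // [_|m m' b b' _ _].
  by rewrite -(scale0r (1 : B)); exact: PZ.
exact: PM.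
Qed.

(** The target carries an arbitrary product and the maps are plain functions, so
    that composites of structure maps can be compared without being packaged. *)
Lemma rack_morphism_ext (T : lmodType k) (mul : T -> T -> T) (f g : B -> T) :
    linear f -> linear g -> f 1 = g 1 ->
    (forall a b, f (a * b) = mul (f a) (f b)) ->
    (forall a b, g (a * b) = mul (g a) (g b)) ->
    (forall x, f (genX x) = g (genX x)) -> (forall x, f (genE x) = g (genE x)) ->
  f =1 g.
Proof.
move=> fl gl e1 fM gM eX eE; apply: rack_ind => // [a b ha hb|c a ha|a b ha hb].
- by rewrite (linD fl) (linD gl) ha hb.
- by rewrite (linZ fl) (linZ gl) ha.
- by rewrite fM gM ha hb.
Qed.

Lemma rack_lift (T : lmodType k) (one : T) (mul : T -> T -> T) (fX fE : X -> T) :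
    associative mul -> left_id one mul -> right_id one mul -> bilin mul ->
    (forall x y, mul (fX y) (fX (op x y)) = mul (fX x) (fX y)) ->
    (forall x y, mul (fX y) (fE (op x y)) = mul (fE x) (fX y)) ->
  exists F : {linear B -> T},
    [/\ F 1 = one, forall a b, F (a * b) = mul (F a) (F b),
        forall x, F (genX x) = fX x & forall x, F (genE x) = fE x].
Proof.
move=> mA m1l m1r mb rX rE.
pose f g := match g with GX x => fX x | GE x => fE x end.
have [|F [Flin F1 FM Fg]] := @palg_lift k _ (@rack_rel k X op) T one mul f mA m1l m1r mb.
  by move=> s t [].
pose F' : {linear B -> T} := HB.pack (F : B -> T) (GRing.isLinear.Build k B T _ F Flin).
exists F'; split=> // x; exact: Fg.
Qed.

(** * The differential, the comultiplication and the counit *)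

Lemma genX_gsign x : gsign (genX x) = genX x.
Proof. by rewrite (gsignE (genX_homog _ _ x)) scale1r. Qed.

(** On the relation y e_(x^y) = e_x y the extended Leibniz rule asks for
    y (1 - x^y) = (1 - x) y, which is the relation y x^y = x y; the other relation
    involves only degree 0, where d vanishes. *)
Lemma rack_d_exists : exists d : {linear B -> B}, is_rack_d d.
Proof.
(* The square-zero extension of B by itself, with twisted left action. *)
pose mul (s t : B * B) : B * B := (s.1 * t.1, s.2 * t.1 + gsign s.1 * t.2).
have mA : associative mul.
  move=> s t u; rewrite /mul /= gsignM; congr pair; first exact: mulrA.
  by rewrite mulrDl mulrDr !mulrA addrA.
have m1l : left_id (1, 0) mul.
  by move=> [a u]; rewrite /mul /= mul1r mul0r add0r gsign1 mul1r.
have m1r : right_id (1, 0) mul.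
  by move=> [a u]; rewrite /mul /= !mulr1 mulr0 addr0.
have mb : bilin mul.
  split=> [[a u] c [b v] [b' v']|[b v] c [a u] [a' u']]; congr pair => /=.
  - exact: mull_lin.
  - rewrite !mulrDr -!scale_mulr addrACA; congr (_ + _).
    by rewrite scalerDr.
  - exact: mulr_lin.
  - by rewrite linearP /= !mulrDl -!scale_mull scalerDr addrACA.
have [|x y|F [F1 FM FX FE]] :=
  @rack_lift _ _ mul (fun x => (genX x, 0)) (fun x => (genE x, 1 - genX x)) mA m1l m1r mb.
- by move=> x y; rewrite /mul /= !mulr0 !mul0r genX_rel.
- rewrite /mul /= mul0r mulr0 add0r addr0 genE_rel genX_gsign.
  by rewrite mulrBr mulrBl mulr1 mul1r genX_rel.
have F1E a : (F a).1 = a.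
  elim/rack_ind: a => [|x|x|a b ha hb|c a ha|a b ha hb].
  - by rewrite F1.
  - by rewrite FX.
  - by rewrite FE.
  - by rewrite linearD /= ha hb.
  - by rewrite linearZ /= ha.
  - by rewrite FM /= ha hb.
pose d a := (F a).2.
have d_lin : linear d by move=> c a b; rewrite /d linearP.
have dM a b : d (a * b) = d a * b + gsign a * d b by rewrite /d FM /= !F1E.
pose d' : {linear B -> B} := HB.pack d (GRing.isLinear.Build k B B _ d d_lin).
have dX x : d (genX x) = 0 by rewrite /d FX.
have dE x : d (genE x) = 1 - genX x by rewrite /d FE.
have d1 : d 1 = 0 by rewrite /d F1.
exists d'; split; last by move=> x; rewrite /= dX dE.
(* The two degree conditions on d feed each other in a product with one factor
   of degree 0, so they are proved together. *)
pose P n a := if n is n'.+1 then homog n' (d a) else d a = 0.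
have dP : forall n a, homog n a -> P n a.
  apply: rack_homog_ind => // [[|n]|x|[|n] a b|[|n] c a|[|m] [|n] a b ha hb] /=.
  - exact: (lin0 d_lin).
  - by rewrite (lin0 d_lin); exact: homog0.
  - rewrite dE -scaleN1r; apply: homogD; first exact: homog1.
    exact/homogZ/genX_homog.
  - by rewrite (linD d_lin) => -> ->; rewrite addr0.
  - by rewrite (linD d_lin); exact: homogD.
  - by rewrite (linZ d_lin) => ->; rewrite scaler0.
  - by rewrite (linZ d_lin); exact: homogZ.
  - by rewrite dM => -> ->; rewrite mul0r mulr0 addr0.
  - rewrite dM (gsignE ha) scale1r => -> db; rewrite mul0r add0r.
    exact: (homogM ha db).
  - rewrite dM addn0 => da ->; rewrite mulr0 addr0 -[m]addn0.
    exact: (homogM da hb).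
  - rewrite dM (gsignE ha) -scale_mull => da db; apply: homogD.
      exact: (homogM da hb).
    by apply: homogZ; rewrite addnS -addSn; exact: homogM ha db.
split=> [n a /dP|a /dP|n a b ha] //=.
by rewrite dM (gsignE ha) scale_mull.
Qed.

(** One factor in each product of the relations is Delta y = y ⊗ y, of degree 0 on
    both sides, so no Koszul sign appears and each relation for Delta reduces to
    the two relations of B, one on each side of the tensor sign. *)
Lemma rack_Delta_exists : exists Delta : {linear B -> (B ⊗ B)%type}, is_rack_Delta Delta.
Proof.
pose T : gradedAlgType k := (B ⊗ B)%type.
have mb : bilin (fun s t : T => s * t) by split=> s; [exact: mull_lin|exact: mulr_lin].
have hX x := genX_homog k op x; have hE x := genE_homog k op x.
have [x y|x y|D [D1 DM DX DE]] := @rack_lift T 1 (fun s t => s * t)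
  (fun x => genX x ⊗ genX x) (fun x => genE x ⊗ genX x + (1 : B) ⊗ genE x)
  (@mulrA _) (@mul1r _) (@mulr1 _) mb.
- by rewrite (tensM _ _ (hX _) (hX _)) (tensM _ _ (hX _) (hX _)) genX_rel.
- rewrite mulrDr mulrDl (tensM _ _ (hX _) (hE _)) (tensM _ _ (hX _) (homog1 _)).
  rewrite (tensM _ _ (hX _) (hX _)) (tensM _ _ (hE _) (hX _)).
  by rewrite genX_rel genE_rel mulr1 mul1r.
exists D; split; last by move=> x; rewrite DX DE.
split; first by split.
apply: rack_homog_ind => [n||x|x|n a b|n c a|m n a b _ _].
- by rewrite linear0; exact: homog0.
- by rewrite D1; exact: homog1.
- by rewrite DX; exact: homog_tpure (hX x) (hX x).
- rewrite DE; apply: homogD; first exact: homog_tpure (hE x) (hX x).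
  exact: homog_tpure (homog1 _) (hE x).
- by rewrite linearD; exact: homogD.
- by rewrite linearZ; exact: homogZ.
- by rewrite DM; exact: homogM.
Qed.

Lemma rack_counit_exists : exists eps : {linear B -> k^o},
  [/\ monoid_morphism eps, forall n (a : B), homog n.+1 a -> eps a = 0,
      forall x, eps (genX x) = 1 & forall x, eps (genE x) = 0].
Proof.
have mb : bilin (fun s t : k^o => s * t).
  by split=> s c t t' /=; rewrite ?mulrDl ?mulrDr /GRing.scale /= ?mulrA // [s * c]mulrC.
have [x y|x y|e [e1 eM eX eE]] := @rack_lift k^o 1 (fun s t => s * t)
  (fun=> 1) (fun=> 0) (@mulrA _) (@mul1r _) (@mulr1 _) mb => //.
  by rewrite mul0r mulr0.
exists e; split=> // n a ha.
pose P m (a : B) := m != 0%N -> e a = 0.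
suff : P n.+1 a by exact.
apply: rack_homog_ind ha => // {n a}.
- by move=> n _; rewrite linear0.
- by move=> x _.
- by move=> n a b ha hb /[dup] /ha + /hb; rewrite linearD => -> ->; rewrite addr0.
- by move=> n c a ha /ha; rewrite linearZ /= => ->; exact: mulr0.
- move=> m n a b _ _ ha hb; rewrite /P addn_eq0 negb_and eM => /orP[/ha|/hb] ->.
    by rewrite mul0r.
  by rewrite mulr0.
Qed.

Lemma rack_d_unique (d d' : {linear B -> B}) : is_rack_d d -> is_rack_d d' -> d' =1 d.
Proof.
move=> [[_ d0 dM] dg] [[_ d0' dM'] dg'].
have h n a : homog n a -> d' a = d a; last first.
  by elim/homog_ind => [n a /h|a b ha hb] //; rewrite !linearD ha hb.
move: n a; apply: rack_homog_ind => [_||x|x|_ a b ha hb|_ c a ha|m n a b hm _ ha hb].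
- by rewrite !linear0.
- by rewrite d0 ?d0'; try exact: homog1.
- by rewrite (dg x).2 (dg' x).2.
- by rewrite (dg x).1 (dg' x).1.
- by rewrite !linearD ha hb.
- by rewrite !linearZ /= ha.
- by rewrite (dM _ _ _ hm) (dM' _ _ _ hm) ha hb.
Qed.

(** * The differential graded bialgebra axioms *)

Section Bialgebra.
Variables (d : {linear B -> B}) (Delta : {linear B -> (B ⊗ B)%type}).
Hypotheses (d_rack : is_rack_d d) (Delta_rack : is_rack_Delta Delta).

Lemma rack_d_d a : d (d a) = 0.
Proof.
have [d_der dg] := d_rack; have d1 := super_derivation1 d_der.
elim/homog_ind: a => [n|a b ha hb]; last by rewrite !linearD ha hb addr0.
move: n; apply: rack_homog_ind => [_||x|x|_ a b ha hb|_ c a ha|m n a b hm _ ha hb].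
- by rewrite !linear0.
- by rewrite d1 linear0.
- by rewrite (dg x).2 linear0.
- by rewrite (dg x).1 linearB /= (dg x).2 d1 subr0.
- by rewrite !linearD ha hb addr0.
- by rewrite !linearZ /= ha scaler0.
by rewrite (super_derivation_sqrM d_der _ hm) ha hb mulr0 mul0r addr0.
Qed.

(** Both sides are derivations along Delta.  On e_x they agree because the terms
    1 ⊗ x of (1 - x) ⊗ x and 1 ⊗ (1 - x) cancel. *)
Lemma rack_coderivation : super_coderivation Delta d.
Proof.
have [d_der dg] := d_rack; have [dS d0 dM] := d_der.
have [[[D1 DM] Dh] Dg] := Delta_rack.
have d1 := super_derivation1 d_der.
move=> a; rewrite -/(tens_der d _).
have tD := linD (@tens_der_linear _ _ d); have tZ := linZ (@tens_der_linear _ _ d).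
have tE u v : tens_der d (u ⊗ v) = d u ⊗ v + gsign u ⊗ d v by rewrite /tens_der !tmapE.
elim/homog_ind: a => [n|a b ha hb]; last by rewrite !linearD /= tD ha hb.
move: n; apply: rack_homog_ind => [_||x|x|_ a b ha hb|_ c a ha|m n a b hm _ ha hb].
- by rewrite !linear0 (lin0 (@tens_der_linear _ _ d)).
- by rewrite D1 tens1 tE d1 linear0 tpure0l tpure0r addr0.
- by rewrite (Dg x).1 tE (dg x).2 linear0 tpure0l tpure0r addr0.
- rewrite (dg x).1 linearB /= D1 (Dg x).1 (Dg x).2 tD !tE (dg x).1 (dg x).2 d1.
  rewrite tpure0l tpure0r gsign1 addr0 add0r tens1.
  rewrite -scaleN1r tpureDl tpureDr tpureZl tpureZr !scaleN1r.
  by rewrite [RHS]addrC addrA subrK.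
- by rewrite !linearD /= tD ha hb.
- by rewrite !linearZ /= tZ ha.
by rewrite (dM _ _ _ hm) linearD linearZ /= !DM ha hb (tens_derM d_der _ (Dh _ _ hm)).
Qed.

Lemma rack_coassociative : coassociative Delta.
Proof.
have [Dmor Dg] := Delta_rack; have [[D1 DM] _] := Dmor.
have [l1 lM] := tmap_morphism Dmor (id_morphism B).
have [r1 rM] := tmap_morphism (id_morphism B) Dmor.
have [a1 aM] := @tassoc_morphism _ B B B.
apply: (@rack_morphism_ext (B ⊗ (B ⊗ B))%type (fun s t => s * t)).
- by move=> c u v; rewrite !linearP.
- by move=> c u v; rewrite !linearP.
- by rewrite /= D1 l1 r1 a1.
- by move=> u v; rewrite /= DM lM aM.
- by move=> u v; rewrite /= DM rM.
- by move=> x; rewrite /= (Dg x).1 !tmapE /= (Dg x).1 tassocE.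
- move=> x; rewrite /= (Dg x).2 !linearD /= !tmapE /= (Dg x).1 (Dg x).2 D1 tens1.
  by rewrite tpureDl tpureDr !linearD /= !tassocE addrA.
Qed.

Lemma rack_counital : exists eps : {linear B -> k^o},
  [/\ is_counit Delta eps, monoid_morphism eps
    & forall n (a : B), homog n.+1 a -> eps a = 0].
Proof.
have [eps [epsM e0 eX eE]] := rack_counit_exists; have e1 := epsM.1.
have [[[D1 DM] _] Dg] := Delta_rack.
exists eps; split=> // a; split.
- apply: (@rack_morphism_ext B (fun s t => s * t)
    (fun a => tunitl (tmap eps idfun (Delta a))) idfun) => //=.
  + by move=> c u v; rewrite !linearP.
  + by rewrite D1 tens1 tmapE tunitlE /= e1 scale1r.
  + by move=> u v; rewrite DM (tunitl_augM epsM e0).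
  + by move=> x; rewrite (Dg x).1 tmapE tunitlE /= eX scale1r.
  + move=> x; rewrite (Dg x).2 !linearD /= !tmapE !tunitlE /= eE e1.
    by rewrite scale0r add0r scale1r.
- apply: (@rack_morphism_ext B (fun s t => s * t)
    (fun a => tunitr (tmap idfun eps (Delta a))) idfun) => //=.
  + by move=> c u v; rewrite !linearP.
  + by rewrite D1 tens1 tmapE tunitrE /= e1 scale1r.
  + by move=> u v; rewrite DM (tunitr_augM epsM e0).
  + by move=> x; rewrite (Dg x).1 tmapE tunitrE /= eX scale1r.
  + move=> x; rewrite (Dg x).2 !linearD /= !tmapE !tunitrE /= eX eE.
    by rewrite scale0r addr0 scale1r.
Qed.

End Bialgebra.
End RackAlgebra.

Theorem theorem1 (k : comPzRingType) (X : Type) (op : X -> X -> X) (hX : is_rack op) :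
  exists (d : {linear rack_alg k op -> rack_alg k op})
         (Delta : {linear rack_alg k op -> (rack_alg k op ⊗ rack_alg k op)%type}),
    [/\ is_rack_d d,
        (forall d', is_rack_d d' -> d' =1 d),
        is_rack_Delta Delta,
        (forall Delta', is_rack_Delta Delta' -> Delta' =1 Delta)
      & dg_bialgebra d Delta].
Proof.
have [d hd] := rack_d_exists k op; have [Delta hD] := rack_Delta_exists k op.
exists d, Delta; split=> // [d'|Delta' hD'|]; first exact: rack_d_unique.
- have [[[D1 DM] _] Dg] := hD; have [[[D1' DM'] _] Dg'] := hD'.
  apply: (rack_morphism_ext (linearP Delta') (linearP Delta) _ DM' DM) => [|x|x].
  + by rewrite D1.
  + by rewrite (Dg x).1 (Dg' x).1.
  + by rewrite (Dg x).2 (Dg' x).2.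
- split; [exact: hD.1|exact: rack_coassociative|exact: rack_counital
         |exact: rack_d_d|exact: hd.1|exact: rack_coderivation].
Qed.
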